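(* Let $0<\alpha<1$, $\sigma>0$, $r>0$, $E>0$, $T>0$ and $Y=4E$. Let $(v,X_f)$ be a sufficiently smooth exact solution of the time-fractional fixed-domain American put equation $${}^{c}_{0}D^{\alpha}_{t} v(\tau,y)-\tfrac12\sigma^2\frac{\partial^2 v}{\partial y^2}-\Big(r-\tfrac{\sigma^2}{2}\Big)\frac{\partial v}{\partial y}-\frac{1}{X_f(\tau)}\frac{dX_f(\tau)}{d\tau}\frac{\partial v}{\partial y}+r v=0,\qquad 0\le \tau\le T,\ 0\le y\le Y,$$ that is, $v:[0,T]\times[0,Y]\to\mathbb{R}$ has continuous partial derivatives (including mixed ones) up to order two in $\tau$ and order four in $y$, and $X_f:[0,T]\to(0,\infty)$ is twice continuously differentiable. Then the Crank-Nicolson Caputo-Fabrizio scheme $\mathcal{F}^m_n=0$ defined in the context is consistent with this equation, of order $\mathcal{O}(\Delta\tau)+\mathcal{O}((\Delta y)^2)$: there is a constant $K$, independent of the mesh sizes $\Delta\tau,\Delta y$ and of $n,m$, such that for all $1\le m\le M-1$ and all $n\ge 1$ with $\tau^{n+1}\le T$ the local truncation error $\mathcal{T}^m_n$ satisfies $$|\mathcal{T}^{m}_{n}|\le K\big(\Delta\tau+(\Delta y)^2\big).$$ In particular $\mathcal{T}^m_n\to 0$ as $(\Delta\tau,\Delta y)\to(0,0)$.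
   Context: The Caputo-Fabrizio derivative of order $\alpha\in(0,1)$ in the time variable is $${}^{c}_{0}D^{\alpha}_{t} v(t,y)=\frac{1}{1-\alpha}\int_0^{t} e^{-\frac{\alpha (t-s)}{1-\alpha}}\,\frac{\partial v}{\partial s}(s,y)\,ds .$$ Here $\sigma$ is the volatility, $r$ the risk-free rate, $E$ the strike price, $T$ the expiry, $X_f$ the normalized free boundary, and $v$ the normalized option value. Mesh: for $M\in\mathbb{N}$ and $\mu>0$ put $\Delta y=Y/M$, $\Delta\tau=\mu(\Delta y)^2$, $y_m=m\Delta y$ for $m=0,\dots,M$, and $\tau^n=t_n=n\Delta\tau$. Difference operator: for grid values $v^m_n$ (approximating $v(\tau^n,y_m)$) and $X^n_f$ (approximating $X_f(\tau^n)$), and for $1\le m\le M-1$, $n\ge1$, $$\mathcal{F}^m_n=\frac{1}{\Delta\tau\,\alpha}\Big(e^{\frac{\alpha}{1-\alpha}\Delta\tau}-1\Big)\sum_{k=1}^{n}\big(v^m_{n+1-k}-v^m_{n-k}\big)e^{-\frac{\alpha}{1-\alpha}k\Delta\tau}-\frac12\sum_{j\in\{n,n+1\}}\Big[\tfrac12\sigma^2\frac{v^{m+1}_{j}-2v^m_{j}+v^{m-1}_{j}}{(\Delta y)^2}+\Big(r-\tfrac{\sigma^2}{2}\Big)\frac{v^{m+1}_{j}-v^{m-1}_{j}}{2\Delta y}+\frac{X^{n+1}_f-X^n_f}{\Delta\tau X^n_f}\,\frac{v^{m+1}_{j}-v^{m-1}_{j}}{2\Delta y}-r v^m_{j}\Big].$$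 The scheme is $\mathcal{F}^m_n=0$. The local truncation error $\mathcal{T}^m_n$ is the value of $\mathcal{F}^m_n$ when the grid values are replaced by the exact ones, $v^m_n=v(\tau^n,y_m)$ and $X^n_f=X_f(\tau^n)$. The scheme is consistent with the equation if $\mathcal{T}^m_n\to0$ as $(\Delta\tau,\Delta y)\to(0,0)$. *)

(* Defs.v *)
From Stdlib Require Import Reals Lra.
From Coquelicot Require Import Coquelicot.
Open Scope R_scope.

Definition Icc (a b : R) : R -> Prop := fun x => a <= x <= b.

Definition rect (T Y : R) : R * R -> Prop :=
  fun p => Icc 0 T (fst p) /\ Icc 0 Y (snd p).

(* Derivatives relative to a domain [D]: two-sided at interior points of a
   closed interval, one-sided at its endpoints. *)
Definition is_derive_within (D : R -> Prop) (f : R -> R) (x l : R) : Prop :=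
  D_in f (fun _ => l) D x.

Definition ex_derive_within (D : R -> Prop) (f : R -> R) (x : R) : Prop :=
  exists l, is_derive_within D f x l.

(* The value is meaningful only where the derivative exists and is unique;
   see [derive_within_unique]. *)
Definition derive_within (D : R -> Prop) (f : R -> R) (x : R) : R :=
  iota (is_derive_within D f x).

Lemma is_derive_within_unique (a b : R) (f : R -> R) (x l l' : R) :
  a < b -> Icc a b x ->
  is_derive_within (Icc a b) f x l -> is_derive_within (Icc a b) f x l' ->
  l = l'.
Proof.
intros Hab Hx H H'.
apply (single_limit (fun y => (f y - f x) / (y - x)) (D_x (Icc a b) x) l l' x);
  [|exact H|exact H'].
intros eps Heps.
unfold D_x, Icc in *.
set (d := Rmin (eps / 2) ((b - a) / 2)).
assert (Hd : 0 < d /\ d < eps /\ d <= (b - a) / 2).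
{ unfold d; split; [|split].
  - apply Rmin_glb_lt; lra.
  - apply Rle_lt_trans with (eps / 2); [apply Rmin_l | lra].
  - apply Rmin_r. }
destruct (Rle_dec (x + d) b) as [Hb|Hb].
- exists (x + d). unfold Rdist. replace (x + d - x) with d by ring.
  rewrite Rabs_pos_eq by lra. repeat split; lra.
- exists (x - d). unfold Rdist. replace (x - d - x) with (- d) by ring.
  rewrite Rabs_Ropp, Rabs_pos_eq by lra. repeat split; lra.
Qed.

Lemma derive_within_unique (a b : R) (f : R -> R) (x l : R) :
  a < b -> Icc a b x -> is_derive_within (Icc a b) f x l ->
  derive_within (Icc a b) f x = l.
Proof.
intros Hab Hx H. unfold derive_within.
apply (iota_unique (V := R_CompleteNormedModule)); [|exact H].
intros l' H'. symmetry. exact (is_derive_within_unique a b f x l l' Hab Hx H H').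
Qed.

Definition d_tau (T : R) (u : R -> R -> R) : R -> R -> R :=
  fun t y => derive_within (Icc 0 T) (fun s => u s y) t.

Definition d_y (Y : R) (u : R -> R -> R) : R -> R -> R :=
  fun t y => derive_within (Icc 0 Y) (fun z => u t z) y.

(* [C_rect T Y i j u]: every iterated partial derivative of [u], taken in any
   order with at most [i] differentiations in tau and at most [j] in y, exists
   and is (jointly) continuous on the closed rectangle. *)
Fixpoint C_rect (T Y : R) (i : nat) : nat -> (R -> R -> R) -> Prop :=
  fix C_rect_i (j : nat) (u : R -> R -> R) : Prop :=
    continuous_on (rect T Y) (fun p => u (fst p) (snd p)) /\
    match i with
    | O => True
    | S i' =>
        (forall t y, Icc 0 T t -> Icc 0 Y y ->
           ex_derive_within (Icc 0 T) (fun s => u s y) t) /\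
        C_rect T Y i' j (d_tau T u)
    end /\
    match j with
    | O => True
    | S j' =>
        (forall t y, Icc 0 T t -> Icc 0 Y y ->
           ex_derive_within (Icc 0 Y) (fun z => u t z) y) /\
        C_rect_i j' (d_y Y u)
    end.

Fixpoint C_on (k : nat) (D : R -> Prop) (f : R -> R) : Prop :=
  continuous_on D f /\
  match k with
  | O => True
  | S k' =>
      (forall x, D x -> ex_derive_within D f x) /\
      C_on k' D (derive_within D f)
  end.

Definition caputo_fabrizio (T alpha : R) (v : R -> R -> R) (t y : R) : R :=
  1 / (1 - alpha) *
  RInt (fun s => exp (- (alpha * (t - s) / (1 - alpha))) * d_tau T v s y) 0 t.

Definition put_equation (T Y alpha sigma r : R)
    (v : R -> R -> R) (X_f : R -> R) (t y : R) : Prop :=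
  caputo_fabrizio T alpha v t y
  - 1 / 2 * sigma ^ 2 * d_y Y (d_y Y v) t y
  - (r - sigma ^ 2 / 2) * d_y Y v t y
  - 1 / X_f t * derive_within (Icc 0 T) X_f t * d_y Y v t y
  + r * v t y = 0.

(* Grid values are indexed as [V n m], time level first. *)
Definition spatial_term (sigma r dtau dy : R)
    (V : nat -> nat -> R) (X : nat -> R) (n m j : nat) : R :=
  1 / 2 * sigma ^ 2 * ((V j (m + 1)%nat - 2 * V j m + V j (m - 1)%nat) / dy ^ 2)
  + (r - sigma ^ 2 / 2) * ((V j (m + 1)%nat - V j (m - 1)%nat) / (2 * dy))
  + (X (n + 1)%nat - X n) / (dtau * X n) *
      ((V j (m + 1)%nat - V j (m - 1)%nat) / (2 * dy))
  - r * V j m.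

(* The memory sum is the Caputo-Fabrizio integral at time n dtau with the tau
   derivative replaced by its difference quotient on each cell and the
   exponential kernel integrated exactly. *)
Definition scheme (alpha sigma r dtau dy : R)
    (V : nat -> nat -> R) (X : nat -> R) (n m : nat) : R :=
  1 / (dtau * alpha) * (exp (alpha / (1 - alpha) * dtau) - 1) *
    sum_n_m (fun k => (V (n + 1 - k)%nat m - V (n - k)%nat m) *
                      exp (- (alpha / (1 - alpha) * INR k * dtau))) 1 n
  - 1 / 2 * (spatial_term sigma r dtau dy V X n m n
             + spatial_term sigma r dtau dy V X n m (n + 1)%nat).

Definition step_y (Y : R) (M : nat) : R := Y / INR M.
Definition step_tau (Y mu : R) (M : nat) : R := mu * step_y Y M ^ 2.

Definition truncation_error (Y alpha sigma r : R) (v : R -> R -> R) (X_f : R -> R)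
    (mu : R) (M n m : nat) : R :=
  let dtau := step_tau Y mu M in
  let dy := step_y Y M in
  scheme alpha sigma r dtau dy
    (fun n m => v (INR n * dtau) (INR m * dy)) (fun n => X_f (INR n * dtau)) n m.

Definition admissible (T Y mu : R) (M n m : nat) : Prop :=
  (1 <= m <= M - 1)%nat /\ (1 <= n)%nat /\ INR (n + 1) * step_tau Y mu M <= T.

(* The truncation error tends to 0 as (dtau, dy) -> (0, 0), uniformly over the
   admissible grid indices. *)
Definition consistent (T Y : R) (err : R -> nat -> nat -> nat -> R) : Prop :=
  forall eps, 0 < eps -> exists delta, 0 < delta /\
    forall (mu : R) (M : nat), 0 < mu -> (0 < M)%nat ->
      step_tau Y mu M < delta -> step_y Y M < delta ->
      forall n m, admissible T Y mu M n m -> Rabs (err mu M n m) < eps.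

Definition consistent_of_order_1_2 (T Y : R)
    (err : R -> nat -> nat -> nat -> R) : Prop :=
  exists K : R, forall (mu : R) (M : nat), 0 < mu -> (0 < M)%nat ->
    forall n m, admissible T Y mu M n m ->
      Rabs (err mu M n m) <= K * (step_tau Y mu M + step_y Y M ^ 2).

(* Main.v *)
Require Import Defs.
From Stdlib Require Import Reals Factorial Lra Lia ClassicalEpsilon.
From Coquelicot Require Import Coquelicot.
Open Scope R_scope.

(** The truncation error is compared with the equation at the single point
    (t, y) = (n dtau, m dy), which holds exactly, so that only two differences
    remain.

    Memory term.  On a cell [a, b] of the time grid the scheme replaces v_tau by
    its difference quotient, which by the mean value theorem is a value of v_tau
    inside the cell; it therefore differs from v_tau by at most
    sup |v_tautau| dtau on the whole cell.  The exponential kernel is integrated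
    exactly and lies in (0, 1], so each cell contributes O(dtau^2), and the
    n = t / dtau <= T / dtau cells together O(dtau): this is [memory_sum_error].

    Spatial term.  Taylor expansion in y makes the centred difference quotients
    O(dy^2)-accurate at the time level j where they are taken.  The levels n and
    n + 1 are both compared with time t, which costs a further O(dtau) because
    v, v_y and v_yy have a bounded tau derivative.  The quotient of X_f
    approximates X_f' / X_f with error O(dtau) because X_f'' is bounded and X_f,
    positive and continuous on a compact interval, is bounded away from 0.  The
    outcome is [spatial_term_error].

    All constants come from boundedness of continuous functions on the compact
    interval or rectangle, hence depend on neither the mesh nor the indices.
    The derivatives involved are one-sided at the boundary of the domain, so the
    mean value theorem and Taylor's inequality are first established for
    derivatives relative to a closed interval. *)

(** * Derivatives relative to a closed interval *)

Lemma is_derive_within_of_is_derive (D : R -> Prop) (f : R -> R) (x l : R) :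
  is_derive f x l -> is_derive_within D f x l.
Proof.
intros H%is_derive_Reals eps Heps.
destruct (H eps Heps) as [d Hd].
exists d; split; [apply cond_pos|].
intros z [[_ Hz] Hzd].
replace z with (x + (z - x)) at 1 by ring.
apply Hd; [lra|exact Hzd].
Qed.

Lemma is_derive_within_minus (D : R -> Prop) (f g : R -> R) (x l k : R) :
  is_derive_within D f x l -> is_derive_within D g x k ->
  is_derive_within D (fun z => f z - g z) x (l - k).
Proof. intros Hf Hg; exact (Dminus D _ _ f g x Hf Hg). Qed.

Lemma is_derive_within_continuous_on (D : R -> Prop) (f df : R -> R) :
  (forall x, D x -> is_derive_within D f x (df x)) -> continuous_on D f.
Proof.
intros Hf x Hx P [eps HP].
destruct (cont_deriv _ _ _ _ (Hf x Hx) eps (cond_pos eps)) as [d [Hd Hfd]].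
exists (mkposreal d Hd); intros z Hz HDz; apply HP.
destruct (Req_dec z x) as [->|Hne].
- apply ball_center.
- apply Hfd; split; [split; [exact HDz|congruence]|exact Hz].
Qed.

(** The nearest point of the interval.  Composing with this map extends a
    function on [a, b] continuously to the line, which makes the theorems on
    functions of a real variable applicable up to the endpoints. *)
Definition clamp (a b x : R) : R := Rmax a (Rmin b x).

Lemma clamp_Icc (a b x : R) : a <= b -> Icc a b (clamp a b x).
Proof.
intros Hab; unfold clamp, Icc, Rmax, Rmin.
destruct (Rle_dec b x), (Rle_dec a _); lra.
Qed.

Lemma clamp_id (a b x : R) : Icc a b x -> clamp a b x = x.
Proof.
unfold clamp, Icc, Rmax, Rmin; intros H.
destruct (Rle_dec b x), (Rle_dec a _); lra.
Qed.

Lemma clamp_1_lipschitz (a b x y : R) :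
  a <= b -> Rabs (clamp a b x - clamp a b y) <= Rabs (x - y).
Proof.
intros Hab; apply Rabs_le.
assert (Hxy := Rle_abs (x - y)); assert (Hyx := Rle_abs (- (x - y))).
rewrite Rabs_Ropp in Hyx; unfold clamp, Rmax, Rmin.
destruct (Rle_dec b x), (Rle_dec b y); repeat destruct (Rle_dec a _); lra.
Qed.

Lemma continuous_clamp (a b : R) (f : R -> R) (x : R) :
  a <= b -> continuous_on (Icc a b) f ->
  continuous (fun z => f (clamp a b z)) x.
Proof.
intros Hab Hf P HP.
destruct (Hf (clamp a b x) (clamp_Icc a b x Hab) P HP) as [d Hd].
exists d; intros z Hz; apply Hd; [|exact (clamp_Icc a b z Hab)].
eapply Rle_lt_trans; [apply (clamp_1_lipschitz a b z x Hab)|exact Hz].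
Qed.

(** * Bounds on compact sets *)

Lemma continuous_on_bounded (a b : R) (f : R -> R) :
  a <= b -> continuous_on (Icc a b) f ->
  exists B, 0 <= B /\ forall x, Icc a b x -> Rabs (f x) <= B.
Proof.
intros Hab Hf.
destruct (continuity_ab_maj (fun z => Rabs (f (clamp a b z))) a b Hab)
  as [x0 [Hx0 _]].
- intros c _; apply continuity_pt_filterlim.
  apply (continuous_comp (fun z => f (clamp a b z)) Rabs);
    [now apply continuous_clamp|apply continuous_Rabs].
- exists (Rabs (f (clamp a b x0))); split; [apply Rabs_pos|].
  intros x Hx; specialize (Hx0 x Hx); cbv beta in Hx0.
  now rewrite (clamp_id a b x Hx) in Hx0.
Qed.

Lemma continuous_on_positive_min (a b : R) (f : R -> R) :
  a <= b -> continuous_on (Icc a b) f -> (forall x, Icc a b x -> 0 < f x) ->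
  exists c, 0 < c /\ forall x, Icc a b x -> c <= f x.
Proof.
intros Hab Hf Hpos.
destruct (continuity_ab_min (fun z => f (clamp a b z)) a b Hab)
  as [x0 [Hx0 _]].
- intros c _; apply continuity_pt_filterlim; now apply continuous_clamp.
- exists (f (clamp a b x0)); split; [now apply Hpos, clamp_Icc|].
  intros x Hx; specialize (Hx0 x Hx); cbv beta in Hx0.
  now rewrite (clamp_id a b x Hx) in Hx0.
Qed.

(** Around each point the function is bounded by some C, and the radius d there
    may be chosen with d <= 1 / C.  A uniform lower bound for the radii, which
    compactness provides, is then at once a uniform upper bound for the
    function. *)
Lemma continuous_on_rect_bounded (T Y : R) (u : R -> R -> R) :
  continuous_on (rect T Y) (fun p => u (fst p) (snd p)) ->
  exists B, 0 <= B /\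
    forall t y, Icc 0 T t -> Icc 0 Y y -> Rabs (u t y) <= B.
Proof.
intros Hu.
assert (Hloc : forall t y, exists d : posreal, Icc 0 T t -> Icc 0 Y y ->
  forall s z, Icc 0 T s -> Icc 0 Y z -> Rabs (s - t) < d -> Rabs (z - y) < d ->
  Rabs (u s z) <= / d).
{ intros t y.
  destruct (excluded_middle_informative (rect T Y (t, y))) as [Hty|Hty];
    [|exists (mkposreal 1 Rlt_0_1); intros Ht Hy; now elim Hty].
  destruct (Hu (t, y) Hty _ (locally_ball (u t y) (mkposreal 1 Rlt_0_1)))
    as [e He].
  assert (Hp : 0 < Rabs (u t y) + 1) by (generalize (Rabs_pos (u t y)); lra).
  assert (Hd : 0 < Rmin e (/ (Rabs (u t y) + 1))).
  { apply Rmin_glb_lt; [apply cond_pos|now apply Rinv_0_lt_compat]. }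
  exists (mkposreal _ Hd); simpl; intros _ _ s z Hs Hz Hst Hzy.
  apply Rle_trans with (Rabs (u t y) + 1).
  - assert (H : Rabs (u s z - u t y) < 1).
    { apply (He (s, z)); split; try assumption; simpl.
      + eapply Rlt_le_trans; [exact Hst|apply Rmin_l].
      + eapply Rlt_le_trans; [exact Hzy|apply Rmin_l]. }
    generalize (Rabs_triang (u s z - u t y) (u t y)).
    replace (u s z - u t y + u t y) with (u s z) by ring; lra.
  - rewrite <- (Rinv_inv (Rabs (u t y) + 1)) at 1.
    apply Rinv_le_contravar; [exact Hd|apply Rmin_r]. }
set (delta t y := proj1_sig (constructive_indefinite_description _ (Hloc t y))).
destruct (compactness_value_2d 0 T 0 Y delta) as [d Hd].
exists (/ d); split; [left; apply Rinv_0_lt_compat, cond_pos|].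
intros s z Hs Hz; apply Rnot_lt_le; intros Hlt.
apply (Hd s z Hs Hz); intros (t & y & Ht & Hy & Hst & Hzy & Hle).
unfold delta in *.
destruct (constructive_indefinite_description _ (Hloc t y)) as [e He]; simpl in *.
specialize (He Ht Hy s z Hs Hz Hst Hzy).
generalize (Rinv_le_contravar d e (cond_pos d) Hle); lra.
Qed.

(** * Mean value theorem, Taylor's inequality and difference quotients *)

Lemma mean_value_within (a b : R) (f df : R -> R) :
  (forall x, Icc a b x -> is_derive_within (Icc a b) f x (df x)) ->
  forall x y, Icc a b x -> Icc a b y ->
  exists xi, Rmin x y <= xi <= Rmax x y /\ f y - f x = df xi * (y - x).
Proof.
intros Hf x y Hx Hy.
assert (Hab : a <= b) by (unfold Icc in *; lra).
destruct (MVT_gen (fun z => f (clamp a b z)) x y df) as [xi [Hxi Heq]].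
- intros z Hz; apply is_derive_Reals; intros eps Heps.
  assert (Hzab : a < z < b).
  { revert Hz; unfold Icc, Rmin, Rmax in *; destruct (Rle_dec x y); lra. }
  destruct (Hf z (conj (Rlt_le _ _ (proj1 Hzab)) (Rlt_le _ _ (proj2 Hzab))) eps Heps)
    as [d [Hd Hfd]].
  assert (Hd' : 0 < Rmin d (Rmin (z - a) (b - z))) by (repeat apply Rmin_glb_lt; lra).
  exists (mkposreal _ Hd'); simpl; intros h Hh Hhd.
  assert (Hh1 := Rlt_le_trans _ _ _ Hhd (Rmin_l _ _)).
  assert (Hh2 := Rlt_le_trans _ _ _ Hhd (Rmin_r _ _)).
  assert (Hh3 := Rlt_le_trans _ _ _ Hh2 (Rmin_l _ _)).
  assert (Hh4 := Rlt_le_trans _ _ _ Hh2 (Rmin_r _ _)).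
  apply Rabs_def2 in Hh3; apply Rabs_def2 in Hh4.
  rewrite !clamp_id by (unfold Icc; lra).
  replace h with (z + h - z) at 2 by ring.
  apply Hfd; split; [split; [unfold Icc; lra|lra]|].
  simpl; unfold Rdist; now replace (z + h - z) with h by ring.
- intros z _; apply continuity_pt_filterlim, (continuous_clamp a b f z Hab).
  exact (is_derive_within_continuous_on _ _ _ Hf).
- exists xi; split; [exact Hxi|].
  now rewrite !clamp_id in Heq by assumption.
Qed.

(** The Taylor polynomial at [c] when [g] lists a function and its successive
    derivatives. *)
Fixpoint taylor_sum (g : nat -> R -> R) (c : R) (n : nat) (x : R) : R :=
  match n with
  | O => 0
  | S n' => taylor_sum g c n' x + g n' c / INR (fact n') * (x - c) ^ n'
  end.

Lemma taylor_sum_center (g : nat -> R -> R) (c : R) (n : nat) :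
  taylor_sum g c (S n) c = g O c.
Proof.
induction n as [|n IH]; [simpl; field|].
change (taylor_sum g c (S n) c + g (S n) c / INR (fact (S n)) * (c - c) ^ S n
        = g O c).
rewrite IH, Rminus_diag, pow_i by lia; ring.
Qed.

Lemma is_derive_taylor_sum (g : nat -> R -> R) (c : R) (n : nat) (x : R) :
  is_derive (taylor_sum g c (S n)) x (taylor_sum (fun i => g (S i)) c n x).
Proof.
induction n as [|n IH].
- apply (is_derive_ext (fun _ => g O c)); [intros z; simpl; field|].
  apply (is_derive_const (K := R_AbsRing) (V := R_NormedModule)).
- change (is_derive (fun z => taylor_sum g c (S n) z
            + g (S n) c / INR (fact (S n)) * (z - c) ^ S n) x
          (taylor_sum (fun i => g (S i)) c n x
            + g (S n) c / INR (fact n) * (x - c) ^ n)).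
  apply (is_derive_plus (K := R_AbsRing) (V := R_NormedModule)); [exact IH|].
  replace (g (S n) c / INR (fact n)) with (g (S n) c / INR (fact (S n)) * INR (S n))
    by (rewrite fact_simpl, mult_INR; field;
        split; [apply INR_fact_neq_0|apply not_0_INR; lia]).
  generalize (g (S n) c / INR (fact (S n))); intros q.
  auto_derive; [easy|].
  change (q * (1 * (INR (S n) * (x + - c) ^ n)) = q * INR (S n) * (x + - c) ^ n).
  generalize (INR (S n)) ((x + - c) ^ n); intros; ring.
Qed.

(** The derivative of a Taylor remainder of [g 0] is the remainder, one order
    lower, of [g 1], and the remainder vanishes at the centre; the mean value
    theorem thus gains one power of |x - c| at each order.  This gives the bound
    without the factor 1 / n!, which the order of convergence does not see. *)
Lemma taylor_within (a b B : R) (n : nat) (g : nat -> R -> R) :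
  0 <= B ->
  (forall i x, (i < n)%nat -> Icc a b x ->
     is_derive_within (Icc a b) (g i) x (g (S i) x)) ->
  (forall x, Icc a b x -> Rabs (g n x) <= B) ->
  forall c x, Icc a b c -> Icc a b x ->
  Rabs (g O x - taylor_sum g c n x) <= B * Rabs (x - c) ^ n.
Proof.
intros HB; revert g; induction n as [|n IH]; intros g Hg HgB c x Hc Hx.
- simpl; rewrite Rminus_0_r, Rmult_1_r; now apply HgB.
- destruct (mean_value_within a b
      (fun z => g O z - taylor_sum g c (S n) z)
      (fun z => g 1%nat z - taylor_sum (fun i => g (S i)) c n z))
    with (x := c) (y := x) as [xi [Hxi Heq]]; try assumption.
  { intros z Hz; apply is_derive_within_minus; [apply Hg; [lia|exact Hz]|].
    apply is_derive_within_of_is_derive, is_derive_taylor_sum. }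
  cbv beta in Heq; rewrite (taylor_sum_center g c n), Rminus_diag, Rminus_0_r in Heq.
  rewrite Heq, Rabs_mult.
  assert (Hxiab : Icc a b xi /\ Rabs (xi - c) <= Rabs (x - c)).
  { revert Hxi; unfold Icc, Rmin, Rmax in *.
    destruct (Rle_dec c x); intros; split; try lra;
      unfold Rabs; destruct (Rcase_abs _), (Rcase_abs _); lra. }
  destruct Hxiab as [Hxiab Hxic].
  apply Rle_trans with (B * Rabs (xi - c) ^ n * Rabs (x - c)).
  + apply Rmult_le_compat_r; [apply Rabs_pos|].
    apply (IH (fun i => g (S i))); try assumption.
    intros i z Hi Hz; apply Hg; [lia|exact Hz].
  + replace (B * Rabs (x - c) ^ S n) with (B * Rabs (x - c) ^ n * Rabs (x - c))
      by (simpl; ring).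
    apply Rmult_le_compat_r; [apply Rabs_pos|].
    apply Rmult_le_compat_l; [exact HB|].
    apply pow_incr; split; [apply Rabs_pos|exact Hxic].
Qed.

Lemma derivative_bounded_lipschitz (a b B : R) (f df : R -> R) :
  (forall x, Icc a b x -> is_derive_within (Icc a b) f x (df x)) ->
  (forall x, Icc a b x -> Rabs (df x) <= B) ->
  forall x y, Icc a b x -> Icc a b y -> Rabs (f y - f x) <= B * Rabs (y - x).
Proof.
intros Hf HB x y Hx Hy.
destruct (mean_value_within a b f df Hf x y Hx Hy) as [xi [Hxi ->]].
rewrite Rabs_mult; apply Rmult_le_compat_r; [apply Rabs_pos|apply HB].
revert Hxi; unfold Icc, Rmin, Rmax in *; destruct (Rle_dec x y); lra.
Qed.

(** The terms of even degree of the expansions at y + h and y - h cancel, so the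
    first surviving error comes from the remainders of order h^3. *)
Lemma central_first_difference_error (a b B : R) (g : nat -> R -> R) :
  0 <= B ->
  (forall i x, (i < 3)%nat -> Icc a b x ->
     is_derive_within (Icc a b) (g i) x (g (S i) x)) ->
  (forall x, Icc a b x -> Rabs (g 3%nat x) <= B) ->
  forall y h, 0 < h -> a <= y - h -> y + h <= b ->
  Rabs ((g O (y + h) - g O (y - h)) / (2 * h) - g 1%nat y) <= B * h ^ 2.
Proof.
intros HB Hg HgB y h Hh Ha Hb.
assert (HT : forall z, Icc a b z -> _) by
  (intros z Hz; exact (taylor_within a b B 3 g HB Hg HgB y z ltac:(unfold Icc; lra) Hz)).
assert (Hp := HT (y + h) ltac:(unfold Icc; lra)).
assert (Hm := HT (y - h) ltac:(unfold Icc; lra)).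
replace (y + h - y) with h in Hp by ring.
replace (y - h - y) with (- h) in Hm by ring.
rewrite Rabs_Ropp in Hm; rewrite (Rabs_pos_eq h) in Hp, Hm by lra.
set (Ep := g O (y + h) - taylor_sum g y 3 (y + h)) in Hp.
set (Em := g O (y - h) - taylor_sum g y 3 (y - h)) in Hm.
replace (_ / _ - _) with ((Ep - Em) / (2 * h))
  by (unfold Ep, Em; simpl; field; lra).
unfold Rdiv; rewrite Rabs_mult, (Rabs_pos_eq (/ (2 * h)))
  by (left; apply Rinv_0_lt_compat; lra).
apply (Rmult_le_reg_r (2 * h)); [lra|].
rewrite Rmult_assoc, Rinv_l, Rmult_1_r by lra.
apply Rle_trans with (1 := Rabs_triang Ep (- Em)).
rewrite Rabs_Ropp; simpl in *; lra.
Qed.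

(** The terms of odd degree cancel, in particular the cubic one, so that the
    remainders of order h^4 are what is divided by h^2. *)
Lemma central_second_difference_error (a b B : R) (g : nat -> R -> R) :
  0 <= B ->
  (forall i x, (i < 4)%nat -> Icc a b x ->
     is_derive_within (Icc a b) (g i) x (g (S i) x)) ->
  (forall x, Icc a b x -> Rabs (g 4%nat x) <= B) ->
  forall y h, 0 < h -> a <= y - h -> y + h <= b ->
  Rabs ((g O (y + h) - 2 * g O y + g O (y - h)) / h ^ 2 - g 2%nat y)
    <= 2 * B * h ^ 2.
Proof.
intros HB Hg HgB y h Hh Ha Hb.
assert (HT : forall z, Icc a b z -> _) by
  (intros z Hz; exact (taylor_within a b B 4 g HB Hg HgB y z ltac:(unfold Icc; lra) Hz)).
assert (Hp := HT (y + h) ltac:(unfold Icc; lra)).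
assert (Hm := HT (y - h) ltac:(unfold Icc; lra)).
replace (y + h - y) with h in Hp by ring.
replace (y - h - y) with (- h) in Hm by ring.
rewrite Rabs_Ropp in Hm; rewrite (Rabs_pos_eq h) in Hp, Hm by lra.
set (Ep := g O (y + h) - taylor_sum g y 4 (y + h)) in Hp.
set (Em := g O (y - h) - taylor_sum g y 4 (y - h)) in Hm.
replace (_ / _ - _) with ((Ep + Em) / h ^ 2)
  by (unfold Ep, Em; simpl; field; lra).
assert (Hh2 : 0 < h ^ 2) by (apply pow_lt; lra).
unfold Rdiv; rewrite Rabs_mult, (Rabs_pos_eq (/ h ^ 2))
  by (left; apply Rinv_0_lt_compat; lra).
apply (Rmult_le_reg_r (h ^ 2)); [lra|].
rewrite Rmult_assoc, Rinv_l, Rmult_1_r by lra.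
apply Rle_trans with (1 := Rabs_triang Ep Em).
simpl in *; lra.
Qed.

(** The difference quotient equals the derivative at some point of [c, d], so it
    approximates the derivative at every point of that interval. *)
Lemma forward_difference_error (a b B : R) (f df ddf : R -> R) :
  (forall x, Icc a b x -> is_derive_within (Icc a b) f x (df x)) ->
  (forall x, Icc a b x -> is_derive_within (Icc a b) df x (ddf x)) ->
  (forall x, Icc a b x -> Rabs (ddf x) <= B) ->
  forall c d s, a <= c -> c < d -> d <= b -> c <= s <= d ->
  Rabs (df s - (f d - f c) / (d - c)) <= B * (d - c).
Proof.
intros Hf Hdf HB c d s Hc Hcd Hd Hs.
destruct (mean_value_within a b f df Hf c d) as [xi [Hxi ->]];
  [unfold Icc; lra|unfold Icc; lra|].
rewrite Rmin_left, Rmax_right in Hxi by lra.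
unfold Rdiv; rewrite Rmult_assoc, Rinv_r, Rmult_1_r by lra.
assert (HB0 : 0 <= B)
  by (apply Rle_trans with (2 := HB c ltac:(unfold Icc; lra)), Rabs_pos).
apply Rle_trans with (B * Rabs (s - xi)).
- apply (derivative_bounded_lipschitz a b B df ddf Hdf HB); unfold Icc; lra.
- apply Rmult_le_compat_l; [exact HB0|apply Rabs_le; lra].
Qed.

(** * The memory term *)

Lemma ex_RInt_exp_kernel (lam t a b c d : R) (f : R -> R) :
  continuous_on (Icc a b) f -> a <= c -> c <= d -> d <= b ->
  ex_RInt (fun s => exp (- (lam * (t - s))) * f s) c d.
Proof.
intros Hf Hc Hcd Hd.
apply (ex_RInt_ext (fun s => exp (- (lam * (t - s))) * f (clamp a b s))).
- rewrite Rmin_left, Rmax_right by exact Hcd.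
  intros s Hs; rewrite clamp_id; [easy|unfold Icc; lra].
- apply (ex_RInt_continuous (V := R_CompleteNormedModule)); intros s _.
  apply (continuous_mult (K := R_AbsRing)).
  + apply (ex_derive_continuous (K := R_AbsRing) (V := R_NormedModule)); auto_derive; easy.
  + apply continuous_clamp; [lra|exact Hf].
Qed.

Lemma is_RInt_exp_kernel (lam t a b : R) : lam <> 0 ->
  is_RInt (fun s => exp (- (lam * (t - s)))) a b
    ((exp (- (lam * (t - b))) - exp (- (lam * (t - a)))) / lam).
Proof.
intros Hl.
replace (_ / lam) with (minus (exp (- (lam * (t - b))) / lam)
                              (exp (- (lam * (t - a))) / lam))
  by (unfold minus, plus, opp; simpl; field; exact Hl).
apply (is_RInt_derive (V := R_CompleteNormedModule)
         (fun s => exp (- (lam * (t - s))) / lam)).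
- intros s _; auto_derive; [easy|unfold Rminus; field; exact Hl].
- intros s _; apply (ex_derive_continuous (K := R_AbsRing) (V := R_NormedModule)); auto_derive; easy.
Qed.

(** Writing the exact kernel integral times the quotient q as the integral of
    kernel * q leaves the integral of kernel * (u' - q), where the kernel is at
    most 1 because the cell lies in the past of t. *)
Lemma memory_cell_error (lam T B t a b : R) (u du ddu : R -> R) :
  0 < lam -> 0 <= a -> a < b -> b <= t -> t <= T ->
  (forall x, Icc 0 T x -> is_derive_within (Icc 0 T) u x (du x)) ->
  (forall x, Icc 0 T x -> is_derive_within (Icc 0 T) du x (ddu x)) ->
  (forall x, Icc 0 T x -> Rabs (ddu x) <= B) ->
  Rabs (RInt (fun s => exp (- (lam * (t - s))) * du s) a b
        - (u b - u a) / (b - a)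
          * ((exp (- (lam * (t - b))) - exp (- (lam * (t - a)))) / lam))
    <= B * (b - a) ^ 2.
Proof.
intros Hlam Ha Hab Hbt HtT Hu Hdu HB.
set (q := (u b - u a) / (b - a)).
assert (Hk := is_RInt_exp_kernel lam t a b ltac:(lra)).
rewrite <- (is_RInt_unique (V := R_CompleteNormedModule) _ _ _ _ Hk).
assert (Hex1 : ex_RInt (fun s => exp (- (lam * (t - s))) * du s) a b).
{ apply (ex_RInt_exp_kernel lam t 0 T); try lra.
  exact (is_derive_within_continuous_on _ _ _ Hdu). }
assert (Hex2 : ex_RInt (fun s => q * exp (- (lam * (t - s)))) a b).
{ apply (ex_RInt_scal (V := R_CompleteNormedModule)); eexists; exact Hk. }
assert (Hq : RInt (fun s => q * exp (- (lam * (t - s)))) a b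
             = q * RInt (fun s => exp (- (lam * (t - s)))) a b).
{ apply (RInt_scal (V := R_CompleteNormedModule)); eexists; exact Hk. }
rewrite <- Hq.
change (Rabs (minus (RInt (fun s => exp (- (lam * (t - s))) * du s) a b)
                    (RInt (fun s => q * exp (- (lam * (t - s)))) a b))
        <= B * (b - a) ^ 2).
rewrite <- (RInt_minus (V := R_CompleteNormedModule)) by assumption.
replace (B * (b - a) ^ 2) with ((b - a) * (B * (b - a))) by ring.
apply abs_RInt_le_const; [lra| |].
- apply (ex_RInt_minus (V := R_CompleteNormedModule)); assumption.
- intros s Hs; unfold minus, plus, opp; simpl.
  replace (exp (- (lam * (t - s))) * du s + - (q * exp (- (lam * (t - s)))))
    with (exp (- (lam * (t - s))) * (du s - q)) by ring.
  rewrite Rabs_mult, <- (Rmult_1_l (B * (b - a))).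
  apply Rmult_le_compat; try apply Rabs_pos.
  + rewrite Rabs_pos_eq by (left; apply exp_pos).
    rewrite <- exp_0; apply Rnot_lt_le; intros H; apply exp_lt_inv in H.
    assert (0 <= lam * (t - s)) by (apply Rmult_le_pos; lra); lra.
  + apply (forward_difference_error 0 T B u du ddu); try assumption; lra.
Qed.

(** The index k of the memory sum counts the cells backwards from time n dtau.
    Hence the induction on p adds the p-th last cell, and compares the first p
    terms of the sum with the integral over the last p cells. *)
Lemma memory_sum_error (lam T B dtau : R) (u du ddu : R -> R) (n : nat) :
  0 < lam -> 0 < dtau -> INR n * dtau <= T ->
  (forall x, Icc 0 T x -> is_derive_within (Icc 0 T) u x (du x)) ->
  (forall x, Icc 0 T x -> is_derive_within (Icc 0 T) du x (ddu x)) ->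
  (forall x, Icc 0 T x -> Rabs (ddu x) <= B) ->
  Rabs (RInt (fun s => exp (- (lam * (INR n * dtau - s))) * du s) 0 (INR n * dtau)
        - (exp (lam * dtau) - 1) / (lam * dtau)
          * sum_n_m (fun k => (u (INR (n + 1 - k) * dtau) - u (INR (n - k) * dtau))
                              * exp (- (lam * INR k * dtau))) 1 n)
    <= B * (INR n * dtau) * dtau.
Proof.
intros Hlam Hdt HnT Hu Hdu HB.
set (t := INR n * dtau).
set (w := fun k => (u (INR (n + 1 - k) * dtau) - u (INR (n - k) * dtau))
                   * exp (- (lam * INR k * dtau))).
assert (Hp : forall p, (p <= n)%nat ->
  Rabs (RInt (fun s => exp (- (lam * (t - s))) * du s) (INR (n - p) * dtau) t
        - (exp (lam * dtau) - 1) / (lam * dtau) * sum_n_m w 1 p)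
    <= B * (INR p * dtau) * dtau).
{ induction p as [|p IH]; intros Hpn.
  - rewrite Nat.sub_0_r; fold t.
    rewrite (RInt_point (V := R_CompleteNormedModule)), sum_n_m_zero by lia.
    unfold zero; simpl; rewrite Rmult_0_r, Rminus_0_r, Rabs_R0; lra.
  - specialize (IH ltac:(lia)).
    set (a := INR (n - S p) * dtau).
    set (b := INR (n - p) * dtau) in *.
    assert (Hb : b = t - INR p * dtau)
      by (unfold b, t; rewrite minus_INR by lia; ring).
    assert (Ha : a = b - dtau)
      by (rewrite Hb; unfold a, t; rewrite minus_INR, S_INR by lia; ring).
    assert (Ha0 : 0 <= a)
      by (unfold a; apply Rmult_le_pos; [apply pos_INR|lra]).
    assert (Hbt : b <= t).
    { rewrite Hb; assert (0 <= INR p * dtau)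
        by (apply Rmult_le_pos; [apply pos_INR|lra]); lra. }
    assert (Hcell := memory_cell_error lam T B t a b u du ddu
      Hlam Ha0 ltac:(lra) Hbt HnT Hu Hdu HB).
    assert (Hc := is_derive_within_continuous_on _ _ _ Hdu).
    rewrite <- (RInt_Chasles (V := R_CompleteNormedModule) _ a b t)
      by (apply (ex_RInt_exp_kernel lam t 0 T); fold t in HnT; (assumption || lra)).
    rewrite sum_n_Sm by lia.
    unfold plus; simpl (AbelianMonoid.plus _ _ _).
    replace (b - a) with dtau in Hcell by lra.
    (* The factor exp (lam dtau) - 1 of the scheme appears here: with
       t - a = (p + 1) dtau and t - b = p dtau, the kernel at b is
       exp (lam dtau) times the kernel at a. *)
    assert (Hw : (u b - u a) / dtau
        * ((exp (- (lam * (t - b))) - exp (- (lam * (t - a)))) / lam)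
      = (exp (lam * dtau) - 1) / (lam * dtau) * w (S p)).
    { unfold w; replace (n + 1 - S p)%nat with (n - p)%nat by lia.
      fold a b.
      replace (- (lam * (t - a))) with (- (lam * INR (S p) * dtau))
        by (rewrite Ha, Hb, S_INR; ring).
      replace (- (lam * (t - b))) with (lam * dtau + - (lam * INR (S p) * dtau))
        by (rewrite Hb, S_INR; ring).
      rewrite exp_plus; field; lra. }
    rewrite Hw in Hcell.
    set (I1 := RInt _ a b) in *; set (I2 := RInt _ b t) in *.
    set (q := (exp (lam * dtau) - 1) / (lam * dtau)) in *.
    change (Rabs (I1 + I2 - q * (sum_n_m w 1 p + w (S p)))
            <= B * (INR (S p) * dtau) * dtau).
    replace (I1 + I2 - _) with ((I1 - q * w (S p)) + (I2 - q * sum_n_m w 1 p)) by ring.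
    apply Rle_trans with (1 := Rabs_triang _ _).
    rewrite S_INR; lra. }
specialize (Hp n (Nat.le_refl n)).
rewrite Nat.sub_diag, Rmult_0_l in Hp; exact Hp.
Qed.

(** * Partial derivatives on the rectangle *)

Lemma C_rect_bounded (T Y : R) (i j : nat) (u : R -> R -> R) :
  C_rect T Y i j u ->
  exists B, 0 <= B /\ forall t y, Icc 0 T t -> Icc 0 Y y -> Rabs (u t y) <= B.
Proof. intros H; apply continuous_on_rect_bounded; destruct i, j; apply H. Qed.

Lemma C_rect_d_tau (T Y : R) (i j : nat) (u : R -> R -> R) :
  C_rect T Y (S i) j u -> C_rect T Y i j (d_tau T u).
Proof. intros H; destruct j; apply H. Qed.

Lemma C_rect_d_y (T Y : R) (i j : nat) (u : R -> R -> R) :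
  C_rect T Y i (S j) u -> C_rect T Y i j (d_y Y u).
Proof. intros H; destruct i; apply H. Qed.

Lemma C_rect_iter_d_y (T Y : R) (i j k : nat) (u : R -> R -> R) :
  C_rect T Y i (k + j) u -> C_rect T Y i j (Nat.iter k (d_y Y) u).
Proof.
revert j; induction k as [|k IH]; intros j H; [exact H|].
apply C_rect_d_y, (IH (S j)); now rewrite Nat.add_succ_r.
Qed.

Lemma is_derive_within_derive_within (a b : R) (f : R -> R) (x : R) :
  a < b -> Icc a b x -> ex_derive_within (Icc a b) f x ->
  is_derive_within (Icc a b) f x (derive_within (Icc a b) f x).
Proof.
intros Hab Hx [l Hl]; now rewrite (derive_within_unique a b f x l Hab Hx Hl).
Qed.

Lemma is_derive_within_d_tau (T Y : R) (i j : nat) (u : R -> R -> R) (t y : R) :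
  0 < T -> C_rect T Y (S i) j u -> Icc 0 T t -> Icc 0 Y y ->
  is_derive_within (Icc 0 T) (fun s => u s y) t (d_tau T u t y).
Proof.
intros HT H Ht Hy; apply is_derive_within_derive_within; [exact HT|exact Ht|].
destruct j; now apply H.
Qed.

Lemma is_derive_within_d_y (T Y : R) (i j : nat) (u : R -> R -> R) (t y : R) :
  0 < Y -> C_rect T Y i (S j) u -> Icc 0 T t -> Icc 0 Y y ->
  is_derive_within (Icc 0 Y) (fun z => u t z) y (d_y Y u t y).
Proof.
intros HY H Ht Hy; apply is_derive_within_derive_within; [exact HY|exact Hy|].
destruct i; now apply H.
Qed.

Lemma C_rect_lipschitz_tau (T Y : R) (i j : nat) (u : R -> R -> R) :
  0 < T -> C_rect T Y (S i) j u ->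
  exists K, 0 <= K /\ forall t t' y, Icc 0 T t -> Icc 0 T t' -> Icc 0 Y y ->
    Rabs (u t' y - u t y) <= K * Rabs (t' - t).
Proof.
intros HT H.
destruct (C_rect_bounded _ _ _ _ _ (C_rect_d_tau _ _ _ _ _ H)) as [K [HK HB]].
exists K; split; [exact HK|intros t t' y Ht Ht' Hy].
apply (derivative_bounded_lipschitz 0 T K (fun s => u s y) (fun s => d_tau T u s y));
  try assumption.
- intros s Hs; now apply (is_derive_within_d_tau T Y i j).
- intros s Hs; now apply HB.
Qed.

Lemma C_rect_lipschitz_y (T Y : R) (i j : nat) (u : R -> R -> R) :
  0 < Y -> C_rect T Y i (S j) u ->
  exists K, 0 <= K /\ forall t y y', Icc 0 T t -> Icc 0 Y y -> Icc 0 Y y' ->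
    Rabs (u t y' - u t y) <= K * Rabs (y' - y).
Proof.
intros HY H.
destruct (C_rect_bounded _ _ _ _ _ (C_rect_d_y _ _ _ _ _ H)) as [K [HK HB]].
exists K; split; [exact HK|intros t y y' Ht Hy Hy'].
apply (derivative_bounded_lipschitz 0 Y K (u t) (d_y Y u t)); try assumption.
- intros z Hz; now apply (is_derive_within_d_y T Y i j).
- intros z Hz; now apply HB.
Qed.

Lemma is_derive_within_iter_d_y (T Y : R) (i j k : nat) (u : R -> R -> R) (t y : R) :
  0 < Y -> C_rect T Y i j u -> (k < j)%nat -> Icc 0 T t -> Icc 0 Y y ->
  is_derive_within (Icc 0 Y) (Nat.iter k (d_y Y) u t) y
    (Nat.iter (S k) (d_y Y) u t y).
Proof.
intros HY H Hk Ht Hy; apply (is_derive_within_d_y T Y i (j - S k)); try assumption.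
apply C_rect_iter_d_y; now replace (k + S (j - S k))%nat with j by lia.
Qed.

(** * The spatial term *)

(** The quotient is taken at the time t' of a grid level and compared with the
    derivative at the time t where the equation is used. *)
Lemma central_first_difference_shifted (T Y : R) (i j : nat) (v : R -> R -> R) :
  0 < T -> 0 < Y -> C_rect T Y (S i) (3 + j) v ->
  exists K, 0 <= K /\ forall t t' y h, Icc 0 T t -> Icc 0 T t' ->
    0 < h -> 0 <= y - h -> y + h <= Y ->
    Rabs ((v t' (y + h) - v t' (y - h)) / (2 * h) - d_y Y v t y)
      <= K * (Rabs (t' - t) + h ^ 2).
Proof.
intros HT HY Hv.
destruct (C_rect_bounded _ _ _ _ _ (C_rect_iter_d_y T Y (S i) j 3 v Hv)) as [B [HB HvB]].
destruct (C_rect_lipschitz_tau T Y i (2 + j) (d_y Y v) HT (C_rect_iter_d_y T Y (S i) (2 + j) 1 v Hv))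
  as [L [HL HvL]].
exists (B + L); split; [lra|intros t t' y h Ht Ht' Hh Ha Hb].
assert (H1 := central_first_difference_error 0 Y B
  (fun k => Nat.iter k (d_y Y) v t') HB
  (fun k z Hk Hz => is_derive_within_iter_d_y T Y (S i) (3 + j) k v t' z HY Hv ltac:(lia) Ht' Hz)
  (fun z Hz => HvB t' z Ht' Hz) y h Hh Ha Hb).
assert (H2 := HvL t t' y Ht Ht' ltac:(unfold Icc; lra)).
change (Rabs ((v t' (y + h) - v t' (y - h)) / (2 * h) - d_y Y v t' y)
        <= B * h ^ 2) in H1.
replace (_ / _ - _) with
  ((v t' (y + h) - v t' (y - h)) / (2 * h) - d_y Y v t' y
   + (d_y Y v t' y - d_y Y v t y)) by ring.
apply Rle_trans with (1 := Rabs_triang _ _).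
assert (0 <= B * Rabs (t' - t)) by (apply Rmult_le_pos; [lra|apply Rabs_pos]).
assert (0 <= L * h ^ 2) by (apply Rmult_le_pos; [lra|apply pow2_ge_0]).
lra.
Qed.

Lemma central_second_difference_shifted (T Y : R) (i : nat) (v : R -> R -> R) :
  0 < T -> 0 < Y -> C_rect T Y (S i) 4 v ->
  exists K, 0 <= K /\ forall t t' y h, Icc 0 T t -> Icc 0 T t' ->
    0 < h -> 0 <= y - h -> y + h <= Y ->
    Rabs ((v t' (y + h) - 2 * v t' y + v t' (y - h)) / h ^ 2 - d_y Y (d_y Y v) t y)
      <= K * (Rabs (t' - t) + h ^ 2).
Proof.
intros HT HY Hv.
destruct (C_rect_bounded _ _ _ _ _ (C_rect_iter_d_y T Y (S i) 0 4 v Hv)) as [B [HB HvB]].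
destruct (C_rect_lipschitz_tau T Y i 2 (d_y Y (d_y Y v)) HT
            (C_rect_iter_d_y T Y (S i) 2 2 v Hv)) as [L [HL HvL]].
exists (2 * B + L); split; [lra|intros t t' y h Ht Ht' Hh Ha Hb].
assert (H1 := central_second_difference_error 0 Y B
  (fun k => Nat.iter k (d_y Y) v t') HB
  (fun k z Hk Hz => is_derive_within_iter_d_y T Y (S i) 4 k v t' z HY Hv Hk Ht' Hz)
  (fun z Hz => HvB t' z Ht' Hz) y h Hh Ha Hb).
assert (H2 := HvL t t' y Ht Ht' ltac:(unfold Icc; lra)).
change (Rabs ((v t' (y + h) - 2 * v t' y + v t' (y - h)) / h ^ 2
              - d_y Y (d_y Y v) t' y) <= 2 * B * h ^ 2) in H1.
replace (_ / _ - _) with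
  ((v t' (y + h) - 2 * v t' y + v t' (y - h)) / h ^ 2 - d_y Y (d_y Y v) t' y
   + (d_y Y (d_y Y v) t' y - d_y Y (d_y Y v) t y)) by ring.
apply Rle_trans with (1 := Rabs_triang _ _).
assert (0 <= B * Rabs (t' - t)) by (apply Rmult_le_pos; [lra|apply Rabs_pos]).
assert (0 <= L * h ^ 2) by (apply Rmult_le_pos; [lra|apply pow2_ge_0]).
lra.
Qed.

Lemma log_derivative_difference_error (T : R) (X : R -> R) :
  0 < T -> C_on 2 (Icc 0 T) X -> (forall t, Icc 0 T t -> 0 < X t) ->
  exists K, 0 <= K /\
    (forall t, Icc 0 T t -> Rabs (1 / X t * derive_within (Icc 0 T) X t) <= K) /\
    (forall t h, 0 < h -> 0 <= t -> t + h <= T ->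
       Rabs ((X (t + h) - X t) / (h * X t)
             - 1 / X t * derive_within (Icc 0 T) X t) <= K * h).
Proof.
intros HT (HXc & HX1 & HX1c & HX2 & HX2c & _) Hpos.
set (dX := derive_within (Icc 0 T) X) in *.
destruct (continuous_on_positive_min 0 T X) as [c [Hc HcX]]; [lra|assumption..|].
destruct (continuous_on_bounded 0 T dX) as [B1 [HB1 HdX]]; [lra|assumption|].
destruct (continuous_on_bounded 0 T (derive_within (Icc 0 T) dX)) as [B2 [HB2 HddX]];
  [lra|assumption|].
assert (Hinv : forall t, Icc 0 T t -> 0 < / X t <= / c).
{ intros t Ht; split; [now apply Rinv_0_lt_compat, Hpos|].
  apply Rinv_le_contravar; [exact Hc|now apply HcX]. }
assert (Hc' := Rinv_0_lt_compat c Hc).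
assert (H1 : 0 <= / c * B1) by (apply Rmult_le_pos; lra).
assert (H2 : 0 <= / c * B2) by (apply Rmult_le_pos; lra).
exists (/ c * B1 + / c * B2); split; [lra|split].
- intros t Ht; apply Rle_trans with (/ c * B1); [|lra].
  unfold Rdiv; rewrite Rmult_1_l, Rabs_mult.
  apply Rmult_le_compat; try apply Rabs_pos; [|now apply HdX].
  rewrite Rabs_pos_eq; generalize (Hinv t Ht); lra.
- intros t h Hh Ht HtT.
  assert (Htt : Icc 0 T t) by (unfold Icc; lra).
  assert (Hf := forward_difference_error 0 T B2 X dX (derive_within (Icc 0 T) dX)
    (fun x Hx => is_derive_within_derive_within 0 T X x HT Hx (HX1 x Hx))
    (fun x Hx => is_derive_within_derive_within 0 T dX x HT Hx (HX2 x Hx))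
    HddX t (t + h) t Ht ltac:(lra) HtT ltac:(lra)).
  replace (t + h - t) with h in Hf by ring.
  rewrite Rabs_minus_sym in Hf.
  replace (_ / _ - _) with (/ X t * ((X (t + h) - X t) / h - dX t))
    by (field; split; [generalize (Hpos t Htt)|]; lra).
  rewrite Rabs_mult.
  apply Rle_trans with (/ c * (B2 * h)).
  + apply Rmult_le_compat; try apply Rabs_pos; [|exact Hf].
    rewrite Rabs_pos_eq; generalize (Hinv t Htt); lra.
  + assert (0 <= / c * B1 * h) by (apply Rmult_le_pos; lra); lra.
Qed.

(** The equation says that the Caputo-Fabrizio derivative of [v] equals this
    expression, of which [spatial_term] is the discretization. *)
Definition spatial_operator (T Y sigma r : R) (v : R -> R -> R) (X_f : R -> R)
    (t y : R) : R :=
  1 / 2 * sigma ^ 2 * d_y Y (d_y Y v) t y + (r - sigma ^ 2 / 2) * d_y Y v t y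
  + 1 / X_f t * derive_within (Icc 0 T) X_f t * d_y Y v t y - r * v t y.

Lemma Rabs_mult_le (x y a b : R) :
  Rabs x <= a -> Rabs y <= b -> Rabs (x * y) <= a * b.
Proof.
intros Hx Hy; rewrite Rabs_mult; apply Rmult_le_compat; auto using Rabs_pos.
Qed.

(** In the advection term the product of approximations is split as
    rho D1 - rho0 v_y = (rho - rho0) D1 + rho0 (D1 - v_y), where D1 is bounded by
    sup |v_y| through the mean value theorem; no product of the two error terms
    dtau and dy^2 arises, so the bound is linear in dtau + dy^2. *)
Lemma spatial_term_error (T Y sigma r : R) (v : R -> R -> R) (X_f : R -> R) :
  0 < T -> 0 < Y -> C_rect T Y 2 4 v -> C_on 2 (Icc 0 T) X_f ->
  (forall t, Icc 0 T t -> 0 < X_f t) ->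
  exists K, 0 <= K /\ forall dtau dy n m j,
    0 < dtau -> 0 < dy -> (1 <= m)%nat -> INR (m + 1) * dy <= Y ->
    INR (n + 1) * dtau <= T -> (j = n \/ j = (n + 1)%nat) ->
    Rabs (spatial_term sigma r dtau dy
            (fun n m => v (INR n * dtau) (INR m * dy)) (fun n => X_f (INR n * dtau))
            n m j
          - spatial_operator T Y sigma r v X_f (INR n * dtau) (INR m * dy))
      <= K * (dtau + dy ^ 2).
Proof.
intros HT HY Hv HX HXpos.
destruct (C_rect_lipschitz_tau T Y 1 4 v HT Hv) as [K0 [HK0 H0]].
destruct (C_rect_lipschitz_y T Y 2 3 v HY Hv) as [B1 [HB1 Hv1]].
destruct (central_first_difference_shifted T Y 1 1 v HT HY Hv) as [K1 [HK1 H1]].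
destruct (central_second_difference_shifted T Y 1 v HT HY Hv) as [K2 [HK2 H2]].
destruct (log_derivative_difference_error T X_f HT HX HXpos) as [KX [HKX [HX0 HX1]]].
set (A2 := Rabs (1 / 2 * sigma ^ 2)); set (A1 := Rabs (r - sigma ^ 2 / 2)).
set (A0 := Rabs r).
assert (HA2 : 0 <= A2) by apply Rabs_pos.
assert (HA1 : 0 <= A1) by apply Rabs_pos.
assert (HA0 : 0 <= A0) by apply Rabs_pos.
exists (A2 * K2 + A1 * K1 + (KX * B1 + KX * K1) + A0 * K0).
split; [repeat apply Rplus_le_le_0_compat; now apply Rmult_le_pos|].
intros dtau dy n m j Hdt Hdy Hm HmY HnT Hj.
unfold spatial_term, spatial_operator.
set (t := INR n * dtau); set (y := INR m * dy); set (t' := INR j * dtau).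
assert (Htn : 0 <= t) by (apply Rmult_le_pos; [apply pos_INR|lra]).
assert (Hyp : INR (m + 1) * dy = y + dy) by (unfold y; rewrite plus_INR; simpl; ring).
assert (Hym : INR (m - 1) * dy = y - dy) by (unfold y; rewrite minus_INR by lia; simpl; ring).
assert (Hy0 : 0 <= INR (m - 1) * dy) by (apply Rmult_le_pos; [apply pos_INR|lra]).
assert (Htp : INR (n + 1) * dtau = t + dtau) by (unfold t; rewrite plus_INR; simpl; ring).
assert (Ht' : Icc 0 T t' /\ Rabs (t' - t) <= dtau).
{ destruct Hj as [->| ->]; fold t in t'; unfold t', Icc.
  - rewrite Rminus_diag, Rabs_R0; lra.
  - rewrite Htp; replace (t + dtau - t) with dtau by ring.
    rewrite Rabs_pos_eq; lra. }
destruct Ht' as [Ht' Htt'].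
rewrite Htp, Hyp, Hym; rewrite Hyp in HmY; rewrite Hym in Hy0; rewrite Htp in HnT.
clearbody t y t'; clear Hj Hm Htp Hyp Hym.
assert (Ht : Icc 0 T t) by (unfold Icc; lra).
specialize (H0 t t' y Ht Ht' ltac:(unfold Icc; lra)).
specialize (H1 t t' y dy Ht Ht' Hdy Hy0 HmY).
specialize (H2 t t' y dy Ht Ht' Hdy Hy0 HmY).
specialize (HX0 t Ht); specialize (HX1 t dtau Hdt Htn HnT).
specialize (Hv1 t' (y - dy) (y + dy) Ht' ltac:(unfold Icc; lra) ltac:(unfold Icc; lra)).
set (eta := dtau + dy ^ 2).
assert (Hdy2 := pow2_ge_0 dy).
assert (Heta : Rabs (t' - t) + dy ^ 2 <= eta) by (unfold eta; lra).
assert (Hle : forall K x, 0 <= K -> x <= eta -> K * x <= K * eta)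
  by (intros; now apply Rmult_le_compat_l).
assert (H0' := Rle_trans _ _ _ H0 (Hle K0 (Rabs (t' - t)) HK0 ltac:(lra))).
assert (H1' := Rle_trans _ _ _ H1 (Hle _ _ HK1 Heta)).
assert (H2' := Rle_trans _ _ _ H2 (Hle _ _ HK2 Heta)).
assert (HX1' := Rle_trans _ _ _ HX1 (Hle KX dtau HKX ltac:(unfold eta; lra))).
set (D1 := (v t' (y + dy) - v t' (y - dy)) / (2 * dy)) in *.
assert (HD1 : Rabs D1 <= B1).
{ unfold D1, Rdiv; rewrite Rabs_mult, Rabs_inv, (Rabs_pos_eq (2 * dy)) by lra.
  apply (Rmult_le_reg_r (2 * dy)); [lra|].
  rewrite Rmult_assoc, Rinv_l, Rmult_1_r by lra.
  replace (y + dy - (y - dy)) with (2 * dy) in Hv1 by ring.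
  now rewrite (Rabs_pos_eq (2 * dy)) in Hv1 by lra. }
set (D2 := (v t' (y + dy) - 2 * v t' y + v t' (y - dy)) / dy ^ 2) in *.
set (rho := (X_f (t + dtau) - X_f t) / (dtau * X_f t)) in *.
set (rho0 := 1 / X_f t * derive_within (Icc 0 T) X_f t) in *.
assert (E2 := Rabs_mult_le _ _ _ _ (Rle_refl A2) H2').
assert (E1 := Rabs_mult_le _ _ _ _ (Rle_refl A1) H1').
assert (E0 := Rabs_mult_le _ _ _ _ (Rle_refl A0) H0').
assert (F1 := Rabs_mult_le _ _ _ _ HX1' HD1).
assert (F2 := Rabs_mult_le _ _ _ _ HX0 H1').
replace (_ - _) with
  (1 / 2 * sigma ^ 2 * (D2 - d_y Y (d_y Y v) t y)
   + (r - sigma ^ 2 / 2) * (D1 - d_y Y v t y)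
   + ((rho - rho0) * D1 + rho0 * (D1 - d_y Y v t y))
   + - (r * (v t' y - v t y))) by ring.
apply Rle_trans with (1 := Rabs_triang _ _); rewrite Rabs_Ropp.
apply Rle_trans with (1 := Rplus_le_compat_r _ _ _ (Rabs_triang _ _)).
apply Rle_trans with
  (1 := Rplus_le_compat_r _ _ _ (Rplus_le_compat _ _ _ _ (Rabs_triang _ _) (Rabs_triang _ _))).
fold A0 in E0. lra.
Qed.

(** * Consistency of the scheme *)

Lemma consistent_of_order_consistent (T Y : R) (err : R -> nat -> nat -> nat -> R) :
  0 < Y -> consistent_of_order_1_2 T Y err -> consistent T Y err.
Proof.
intros HY [K HK] eps Heps.
assert (HK' : 0 < Rabs K + 1) by (generalize (Rabs_pos K); lra).
set (K' := Rabs K + 1) in *.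
assert (HKK' : K <= K') by (generalize (Rle_abs K); unfold K'; lra).
assert (Hq : 0 < eps / (2 * K')) by (apply Rdiv_lt_0_compat; lra).
exists (Rmin 1 (eps / (2 * K'))); split; [apply Rmin_glb_lt; lra|].
intros mu M Hmu HM Ht Hy n m Hadm.
assert (Hdy : 0 < step_y Y M) by (apply Rdiv_lt_0_compat; [lra|now apply lt_0_INR]).
assert (Hdy2 : 0 < step_y Y M ^ 2) by now apply pow_lt.
assert (Hdt : 0 < step_tau Y mu M) by now apply Rmult_lt_0_compat.
apply Rle_lt_trans with (1 := HK mu M Hmu HM n m Hadm).
assert (Ht2 := Rlt_le_trans _ _ _ Ht (Rmin_r _ _)).
assert (Hy1 := Rlt_le_trans _ _ _ Hy (Rmin_l _ _)).
assert (Hy2 := Rlt_le_trans _ _ _ Hy (Rmin_r _ _)).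
assert (Hsq : step_y Y M ^ 2 <= step_y Y M) by nra.
apply Rle_lt_trans with (K' * (step_tau Y mu M + step_y Y M ^ 2)).
- apply Rmult_le_compat_r; lra.
- replace eps with (K' * (2 * (eps / (2 * K')))) by (field; lra).
  apply Rmult_lt_compat_l; lra.
Qed.

Theorem theorem4p2 (alpha sigma r E T Y : R) (v : R -> R -> R) (X_f : R -> R)
  (Halpha : 0 < alpha < 1) (Hsigma : 0 < sigma) (Hr : 0 < r) (HE : 0 < E)
  (HT : 0 < T) (HY : Y = 4 * E)
  (Hv : C_rect T Y 2 4 v)
  (HX : C_on 2 (Icc 0 T) X_f)
  (HXpos : forall t, Icc 0 T t -> 0 < X_f t)
  (Heq : forall t y, Icc 0 T t -> Icc 0 Y y ->
     put_equation T Y alpha sigma r v X_f t y) :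
  consistent_of_order_1_2 T Y (truncation_error Y alpha sigma r v X_f) /\
  consistent T Y (truncation_error Y alpha sigma r v X_f).
Proof.
assert (HY0 : 0 < Y) by lra; clear HY E HE.
enough (Hord : consistent_of_order_1_2 T Y (truncation_error Y alpha sigma r v X_f))
  by (split; [|apply consistent_of_order_consistent]; assumption).
set (lam := alpha / (1 - alpha)).
assert (Hlam : 0 < lam) by (apply Rdiv_lt_0_compat; lra).
assert (H1a : 0 < 1 / (1 - alpha)) by (apply Rdiv_lt_0_compat; lra).
destruct (C_rect_bounded _ _ _ _ _
  (C_rect_d_tau _ _ _ _ _ (C_rect_d_tau _ _ _ _ _ Hv))) as [B [HB HvB]].
destruct (spatial_term_error T Y sigma r v X_f HT HY0 Hv HX HXpos) as [K [HK Hsp]].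
exists (1 / (1 - alpha) * (B * T) + K).
intros mu M Hmu HM n m (Hm & Hn & HnT).
unfold truncation_error.
assert (Hdy : 0 < step_y Y M) by (apply Rdiv_lt_0_compat; [lra|now apply lt_0_INR]).
assert (Hdt : 0 < step_tau Y mu M) by now apply Rmult_lt_0_compat, pow_lt.
assert (HmY : INR (m + 1) * step_y Y M <= Y).
{ unfold step_y; replace Y with (INR M * (Y / INR M)) at 2
    by (field; apply not_0_INR; lia).
  apply Rmult_le_compat_r; [left; exact Hdy|apply le_INR; lia]. }
set (dy := step_y Y M) in *; set (dtau := step_tau Y mu M) in *; clearbody dy dtau.
set (t := INR n * dtau); set (y := INR m * dy).
assert (Ht0 : 0 <= t) by (apply Rmult_le_pos; [apply pos_INR|lra]).
assert (HtT : t <= T).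
{ apply Rle_trans with (2 := HnT); apply Rmult_le_compat_r; [lra|apply le_INR; lia]. }
assert (Hy : Icc 0 Y y).
{ split; [apply Rmult_le_pos; [apply pos_INR|lra]|].
  apply Rle_trans with (2 := HmY); apply Rmult_le_compat_r; [lra|apply le_INR; lia]. }
assert (Hmem := memory_sum_error lam T B dtau (fun s => v s y) (fun s => d_tau T v s y)
  (fun s => d_tau T (d_tau T v) s y) n Hlam Hdt HtT
  (fun s Hs => is_derive_within_d_tau T Y 1 4 v s y HT Hv Hs Hy)
  (fun s Hs => is_derive_within_d_tau T Y 0 4 (d_tau T v) s y HT
                 (C_rect_d_tau _ _ _ _ _ Hv) Hs Hy)
  (fun s Hs => HvB s y Hs Hy)).
assert (Hs0 := Hsp dtau dy n m n Hdt Hdy (proj1 Hm) HmY HnT (or_introl eq_refl)).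
assert (Hs1 := Hsp dtau dy n m (n + 1)%nat Hdt Hdy (proj1 Hm) HmY HnT (or_intror eq_refl)).
specialize (Heq t y (conj Ht0 HtT) Hy); unfold put_equation, caputo_fabrizio in Heq.
rewrite (RInt_ext (V := R_CompleteNormedModule) _
  (fun s => exp (- (lam * (t - s))) * d_tau T v s y)) in Heq
  by (intros s _; do 3 f_equal; unfold lam, Rdiv; ring).
fold t y in Hmem, Hs0, Hs1.
unfold scheme; fold lam.
set (S := sum_n_m _ 1 n) in Hmem |- *.
set (I := RInt _ 0 t) in Hmem, Heq.
set (s0 := spatial_term _ _ _ _ _ _ _ _ n) in *.
set (s1 := spatial_term _ _ _ _ _ _ _ _ (n + 1)) in *.
set (L := spatial_operator _ _ _ _ _ _ _ _) in *.
(* The equation makes the exact memory integral and the exact spatial operator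
   equal; the rest is the sum of the two discretization errors.  The prefactor
   1 / (dtau alpha) of the scheme is 1 / (1 - alpha) times 1 / (lam dtau). *)
assert (HL : 1 / (1 - alpha) * I = L) by (unfold L, spatial_operator; lra).
replace (_ - _) with
  (1 / (1 - alpha) * - (I - (exp (lam * dtau) - 1) / (lam * dtau) * S)
   + - (1 / 2) * ((s0 - L) + (s1 - L)))
  by (rewrite <- HL; unfold lam; field; lra).
apply Rle_trans with (1 := Rabs_triang _ _).
rewrite !Rabs_mult, !Rabs_Ropp, (Rabs_pos_eq (1 / 2)), (Rabs_pos_eq (1 / (1 - alpha)))
  by lra.
apply Rle_trans with
  (1 / (1 - alpha) * (B * T * dtau) + 1 / 2 * (2 * (K * (dtau + dy ^ 2)))).
- apply Rplus_le_compat; apply Rmult_le_compat_l; try lra.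
  + apply Rle_trans with (1 := Hmem).
    apply Rmult_le_compat_r; [lra|now apply Rmult_le_compat_l].
  + apply Rle_trans with (1 := Rabs_triang _ _); lra.
- assert (0 <= 1 / (1 - alpha) * (B * T) * dy ^ 2).
  { repeat apply Rmult_le_pos; try lra; apply pow2_ge_0. }
  lra.
Qed.
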